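(* Let $\mathcal{B}=(a_1,a_2)\subset\mathbb{R}$, $\tau>0$, and let $\rho_0>0$ be constant. Let $e=e(p)$ be a smooth function, let $S(p)=\rho_0 e'(p)$, and let $u=u(x,t)$ be a smooth displacement field on $\mathcal{B}\times[0,\tau]$ with velocity $v=\partial_t u$ that satisfies the balance of momentum $\rho_0\,\partial_t v=\partial_x\big(S(\partial_x u)\big)$ and the isentropic balance of energy $\rho_0\,\partial_t I=\partial_x\big(v\,S(\partial_x u)\big)$, where $I=e(\partial_x u)+\tfrac12 v^2$ is the total energy. Put $c(x,t)=S'(\partial_x u(x,t))$. Then the actual evolution of the total energy in $[0,\tau]$ coincides with the stationary points of the functional $$\int_0^\tau \Sigma(I)\,dt,\qquad \Sigma(I)=\int_{\mathcal{B}}\frac12\left(\rho_0\left(\frac{\partial I}{\partial t}\right)^2-c\left(\frac{\partial I}{\partial x}\right)^2\right)dx .$$ That is, the total energy $I=e(\partial_x u)+\tfrac12 v^2$ satisfies $$\rho_0\frac{\partial^2 I}{\partial t^2}-\frac{\partial}{\partial x}\left(c\,\frac{\partial I}{\partial x}\right)=0\quad\text{in }\mathcal{B}\times(0,\tau),$$ and a smooth field $I$ satisfies this equation if and only if it is a stationary point of $\int_0^\tau\Sigma\,dt$.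
   Context: One-dimensional continuum mechanics in material coordinates, isentropic case (no heat flux, no body forces, no heat sources). All fields are assumed smooth on $\overline{\mathcal{B}}\times[0,\tau]$. In the functional, the coefficient $c=c(x,t)$ (the nonlinear elastic modulus evaluated along the given motion) is a fixed given function and is not varied; only $I$ is varied. A field $I$ is a stationary point of $\int_0^\tau\Sigma\,dt$ if $\frac{d}{d\epsilon}\big|_{\epsilon=0}\int_0^\tau\Sigma(I+\epsilon\varphi)\,dt=0$ for every smooth $\varphi$ compactly supported in $\mathcal{B}\times(0,\tau)$. *)

(* Defs.v *)
From Stdlib Require Export Reals.
From Coquelicot Require Export Coquelicot.
Open Scope R_scope.

(** A field is a total function [f x t] of which only the values on the closed
    space-time rectangle matter. The equations are imposed at interior points,
    and the integrals do not depend on the integrand at the endpoints, so the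
    values of [Derive] on the boundary (where it is two-sided) play no role. *)
Definition field := R -> R -> R.

Definition dx (f : field) : field := fun x t => Derive (fun y => f y t) x.
Definition dt (f : field) : field := fun x t => Derive (fun s => f x s) t.

Definition smooth (g : R -> R) : Prop :=
  forall (n : nat) (p : R), ex_derive_n g n p.

Definition smooth_plane (f : field) : Prop :=
  forall (n : nat) (x t : R), ex_diff_n f n x t.

Definition in_domain (a1 a2 tau x t : R) : Prop :=
  (a1 < x < a2) /\ (0 < t < tau).

Definition in_closed_domain (a1 a2 tau x t : R) : Prop :=
  (a1 <= x <= a2) /\ (0 <= t <= tau).

(** Smoothness on a closed set: being there the restriction of a smooth
    function on the plane. *)
Definition smooth_closed (a1 a2 tau : R) (f : field) : Prop :=
  exists g : field, smooth_plane g /\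
    forall x t : R, in_closed_domain a1 a2 tau x t -> f x t = g x t.

(** A closed subset of the plane contained in the (bounded) open rectangle is
    compact, so [closed K] is all that has to be required of [K]. *)
Definition test_field (a1 a2 tau : R) (phi : field) : Prop :=
  smooth_plane phi /\
  exists K : R * R -> Prop,
    closed K /\
    (forall x t : R, K (x, t) -> in_domain a1 a2 tau x t) /\
    (forall x t : R, ~ K (x, t) -> phi x t = 0).

Definition stress (rho0 : R) (e : R -> R) : R -> R :=
  fun p => rho0 * Derive e p.

Definition velocity (u : field) : field := dt u.

Definition total_energy (e : R -> R) (u : field) : field :=
  fun x t => e (dx u x t) + / 2 * (velocity u x t) ^ 2.

Definition modulus (rho0 : R) (e : R -> R) (u : field) : field :=
  fun x t => Derive (stress rho0 e) (dx u x t).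

Definition momentum_balance (a1 a2 tau rho0 : R) (e : R -> R) (u : field)
  : Prop :=
  forall x t : R, in_domain a1 a2 tau x t ->
    rho0 * dt (velocity u) x t
    = dx (fun y s => stress rho0 e (dx u y s)) x t.

Definition energy_balance (a1 a2 tau rho0 : R) (e : R -> R) (u : field)
  : Prop :=
  forall x t : R, in_domain a1 a2 tau x t ->
    rho0 * dt (total_energy e u) x t
    = dx (fun y s => velocity u y s * stress rho0 e (dx u y s)) x t.

Definition wave_equation (a1 a2 tau rho0 : R) (c I : field) : Prop :=
  forall x t : R, in_domain a1 a2 tau x t ->
    rho0 * dt (dt I) x t - dx (fun y s => c y s * dx I y s) x t = 0.

Definition Sigma (a1 a2 rho0 : R) (c I : field) (t : R) : R :=
  RInt (fun x => / 2 * (rho0 * (dt I x t) ^ 2 - c x t * (dx I x t) ^ 2)) a1 a2.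

Definition action (a1 a2 tau rho0 : R) (c I : field) : R :=
  RInt (fun t => Sigma a1 a2 rho0 c I t) 0 tau.

Definition stationary (a1 a2 tau rho0 : R) (c I : field) : Prop :=
  forall phi : field, test_field a1 a2 tau phi ->
    is_derive (fun eps : R =>
      action a1 a2 tau rho0 c (fun x t => I x t + eps * phi x t)) 0 0.

(* Main.v *)
Require Import Defs.
From Stdlib Require Import Lra Lia FunctionalExtensionality.

(** Energy balance says [rho0 I_t = (v S)_x] and momentum balance gives
    [c I_x = (v S)_t], so the wave equation is the equality of the mixed second
    derivatives of [v S]. The action is quadratic, hence its derivative along a
    test field is its polar form; integrating by parts (differentiation under
    the integral sign replaces Fubini) turns it into minus the integral of the
    test field against the residual [r] of the wave equation. Conversely,
    testing with [r] times a smooth bump [b >= 0] gives the integral of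
    [r^2 b] equal to zero, and [r = 0] follows.

    All of this is done for smooth fields on the plane; the fields of the
    theorem agree with such fields in the open rectangle, which is all that the
    equations and the integrals see. *)

(** * Smooth fields on the plane *)

(** The order is fixed here so that closure properties can be proved by induction on it;
    [smooth_plane] asks for all orders at once. *)
Definition C_plane (n : nat) (f : field) : Prop :=
  forall x t : R, ex_diff_n f n x t.

Lemma C_plane_continuity (n : nat) (f : field) (x t : R) :
  C_plane n f -> continuity_2d_pt f x t.
Proof. intros H. specialize (H x t). destruct n; apply H. Qed.

Lemma C_plane_weaken (n : nat) (f : field) : C_plane (S n) f -> C_plane n f.
Proof. intros H x t. apply (ex_diff_n_m (S n)); [lia | apply H]. Qed.

Lemma C_plane_dx (n : nat) (f : field) : C_plane (S n) f -> C_plane n (dx f).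
Proof. intros H x t. apply (H x t). Qed.

Lemma C_plane_dt (n : nat) (f : field) : C_plane (S n) f -> C_plane n (dt f).
Proof. intros H x t. apply (H x t). Qed.

Lemma C_plane_is_derive_x (n : nat) (f : field) (x t : R) :
  C_plane (S n) f -> is_derive (fun y => f y t) x (dx f x t).
Proof. intros H. apply Derive_correct, (H x t). Qed.

Lemma C_plane_is_derive_t (n : nat) (f : field) (x t : R) :
  C_plane (S n) f -> is_derive (fun s => f x s) t (dt f x t).
Proof. intros H. apply Derive_correct, (H x t). Qed.

(** Introduction rule for the inductions below. [ex_diff_n] speaks of [Derive], whereas sum, product
    and chain rule supply the partial derivatives as explicit formulas; uniqueness of derivatives
    identifies the two. *)
Lemma C_plane_S (n : nat) (f fx ft : field) :
  (forall x t, continuity_2d_pt f x t) ->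
  (forall x t, is_derive (fun y => f y t) x (fx x t)) ->
  (forall x t, is_derive (fun s => f x s) t (ft x t)) ->
  C_plane n fx -> C_plane n ft -> C_plane (S n) f.
Proof.
  intros Hc Hx Ht Cx Ct x t.
  split; [apply Hc | split; [eexists; apply Hx | split; [eexists; apply Ht | split]]].
  - apply ex_diff_n_ext_loc with (2 := Cx x t).
    exists (mkposreal 1 Rlt_0_1); intros; symmetry; apply is_derive_unique, Hx.
  - apply ex_diff_n_ext_loc with (2 := Ct x t).
    exists (mkposreal 1 Rlt_0_1); intros; symmetry; apply is_derive_unique, Ht.
Qed.

Lemma C_plane_const (n : nat) (a : R) : C_plane n (fun _ _ => a).
Proof.
  revert a; induction n as [|n IH]; intros a.
  - intros x t; split; [apply continuity_2d_pt_const | exact I].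
  - apply C_plane_S with (fun _ _ => 0) (fun _ _ => 0);
      try (intros; auto_derive; easy || reflexivity); auto.
    intros; apply continuity_2d_pt_const.
Qed.

Lemma C_plane_fst (n : nat) : C_plane n (fun x _ => x).
Proof.
  destruct n as [|n].
  - intros x t; split; [apply continuity_2d_pt_id1 | exact I].
  - apply C_plane_S with (fun _ _ => 1) (fun _ _ => 0); try apply C_plane_const;
      try (intros; auto_derive; easy || reflexivity).
    intros; apply continuity_2d_pt_id1.
Qed.

Lemma C_plane_snd (n : nat) : C_plane n (fun _ t => t).
Proof.
  destruct n as [|n].
  - intros x t; split; [apply continuity_2d_pt_id2 | exact I].
  - apply C_plane_S with (fun _ _ => 0) (fun _ _ => 1); try apply C_plane_const;
      try (intros; auto_derive; easy || reflexivity).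
    intros; apply continuity_2d_pt_id2.
Qed.

Lemma C_plane_plus (n : nat) (f g : field) :
  C_plane n f -> C_plane n g -> C_plane n (fun x t => f x t + g x t).
Proof.
  revert f g; induction n as [|n IH]; intros f g Hf Hg.
  - intros x t; split; [apply continuity_2d_pt_plus; [apply Hf | apply Hg] | exact I].
  - apply C_plane_S with (fun x t => dx f x t + dx g x t)
                         (fun x t => dt f x t + dt g x t).
    + intros; apply continuity_2d_pt_plus; eapply C_plane_continuity; eauto.
    + intros; apply @is_derive_plus; eapply C_plane_is_derive_x; eauto.
    + intros; apply @is_derive_plus; eapply C_plane_is_derive_t; eauto.
    + apply IH; apply C_plane_dx; auto.
    + apply IH; apply C_plane_dt; auto.
Qed.

Lemma is_derive_mult_R (f g : R -> R) (x df dg : R) :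
  is_derive f x df -> is_derive g x dg ->
  is_derive (fun y => f y * g y) x (df * g x + f x * dg).
Proof.
  intros Hf Hg. apply @is_derive_mult; auto. exact Rmult_comm.
Qed.

(** By the Leibniz rule the partial derivatives are sums of products of a factor with a derivative,
    so the induction hypothesis is applied to the undifferentiated factors too, after lowering their
    order by one. *)
Lemma C_plane_mult (n : nat) (f g : field) :
  C_plane n f -> C_plane n g -> C_plane n (fun x t => f x t * g x t).
Proof.
  revert f g; induction n as [|n IH]; intros f g Hf Hg.
  - intros x t; split; [apply continuity_2d_pt_mult; [apply Hf | apply Hg] | exact I].
  - apply C_plane_S with (fun x t => dx f x t * g x t + f x t * dx g x t)
                         (fun x t => dt f x t * g x t + f x t * dt g x t).
    + intros; apply continuity_2d_pt_mult; eapply C_plane_continuity; eauto.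
    + intros x t. apply (is_derive_mult_R (fun y => f y t) (fun y => g y t));
        eapply C_plane_is_derive_x; eauto.
    + intros x t. apply (is_derive_mult_R (fun s => f x s) (fun s => g x s));
        eapply C_plane_is_derive_t; eauto.
    + apply C_plane_plus; apply IH; auto using C_plane_dx, C_plane_weaken.
    + apply C_plane_plus; apply IH; auto using C_plane_dt, C_plane_weaken.
Qed.

Lemma is_derive_comp_R (f g : R -> R) (x df dg : R) :
  is_derive f (g x) df -> is_derive g x dg ->
  is_derive (fun y => f (g y)) x (df * dg).
Proof.
  intros Hf Hg. rewrite Rmult_comm. apply (is_derive_comp f g x df dg Hf Hg).
Qed.

(** The chain rule turns [h] into some [h'] in the same class, so the induction on the order only
    needs a class [F] in which every member has a derivative. It is used for the class [smooth] and
    for the span of the flat functions below. *)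
Lemma C_plane_comp (F : (R -> R) -> Prop) :
  (forall h, F h -> exists h', F h' /\ forall y, is_derive h y (h' y)) ->
  forall (n : nat) (h : R -> R) (f : field),
    F h -> C_plane n f -> C_plane n (fun x t => h (f x t)).
Proof.
  intros HF n; induction n as [|n IH]; intros h f Hh Hf;
    destruct (HF h Hh) as (h' & Hh' & D).
  - intros x t; split; [|exact I].
    apply continuity_1d_2d_pt_comp; [|apply Hf].
    apply derivable_continuous_pt. exists (h' (f x t)). apply is_derive_Reals, D.
  - apply C_plane_S with (fun x t => h' (f x t) * dx f x t)
                         (fun x t => h' (f x t) * dt f x t).
    + intros x t. apply continuity_1d_2d_pt_comp; [|eapply C_plane_continuity; eauto].
      apply derivable_continuous_pt. exists (h' (f x t)). apply is_derive_Reals, D.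
    + intros x t. apply (is_derive_comp_R h (fun y => f y t)); [apply D|].
      eapply C_plane_is_derive_x; eauto.
    + intros x t. apply (is_derive_comp_R h (fun s => f x s)); [apply D|].
      eapply C_plane_is_derive_t; eauto.
    + apply C_plane_mult; auto using C_plane_dx, C_plane_weaken.
    + apply C_plane_mult; auto using C_plane_dt, C_plane_weaken.
Qed.

Lemma smooth_plane_C (n : nat) (f : field) : smooth_plane f -> C_plane n f.
Proof. intros H x t; apply H. Qed.

Lemma C_smooth_plane (f : field) : (forall n, C_plane n f) -> smooth_plane f.
Proof. intros H n x t; apply H. Qed.

Lemma smooth_plane_const (a : R) : smooth_plane (fun _ _ => a).
Proof. apply C_smooth_plane; intro; apply C_plane_const. Qed.

Lemma smooth_plane_plus (f g : field) :
  smooth_plane f -> smooth_plane g -> smooth_plane (fun x t => f x t + g x t).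
Proof. intros; apply C_smooth_plane; intro; apply C_plane_plus; apply smooth_plane_C; auto. Qed.

Lemma smooth_plane_mult (f g : field) :
  smooth_plane f -> smooth_plane g -> smooth_plane (fun x t => f x t * g x t).
Proof. intros; apply C_smooth_plane; intro; apply C_plane_mult; apply smooth_plane_C; auto. Qed.

Lemma smooth_plane_scal (a : R) (f : field) :
  smooth_plane f -> smooth_plane (fun x t => a * f x t).
Proof. intros. apply smooth_plane_mult; auto using smooth_plane_const. Qed.

Lemma smooth_plane_minus (f g : field) :
  smooth_plane f -> smooth_plane g -> smooth_plane (fun x t => f x t - g x t).
Proof.
  intros Hf Hg. replace (fun x t => f x t - g x t) with (fun x t => f x t + (-1) * g x t).
  - apply smooth_plane_plus; [auto | now apply smooth_plane_scal].
  - do 2 (apply functional_extensionality; intro). ring.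
Qed.

Lemma smooth_plane_dx (f : field) : smooth_plane f -> smooth_plane (dx f).
Proof. intros; apply C_smooth_plane; intro; now apply C_plane_dx, smooth_plane_C. Qed.

Lemma smooth_plane_dt (f : field) : smooth_plane f -> smooth_plane (dt f).
Proof. intros; apply C_smooth_plane; intro; now apply C_plane_dt, smooth_plane_C. Qed.

Lemma smooth_plane_is_derive_x (f : field) (x t : R) :
  smooth_plane f -> is_derive (fun y => f y t) x (dx f x t).
Proof. intros H; apply (C_plane_is_derive_x 0), smooth_plane_C, H. Qed.

Lemma smooth_plane_is_derive_t (f : field) (x t : R) :
  smooth_plane f -> is_derive (fun s => f x s) t (dt f x t).
Proof. intros H; apply (C_plane_is_derive_t 0), smooth_plane_C, H. Qed.

Lemma smooth_plane_continuity (f : field) (x t : R) :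
  smooth_plane f -> continuity_2d_pt f x t.
Proof. intros H; apply (C_plane_continuity 0), smooth_plane_C, H. Qed.

Lemma smooth_plane_continuous_x (f : field) (x t : R) :
  smooth_plane f -> continuous (fun y => f y t) x.
Proof.
  intros H; apply (ex_derive_continuous (fun y => f y t)).
  eexists; now apply smooth_plane_is_derive_x.
Qed.

Lemma smooth_plane_dx_plus (f g : field) (x t : R) :
  smooth_plane f -> smooth_plane g ->
  dx (fun y s => f y s + g y s) x t = dx f x t + dx g x t.
Proof.
  intros; apply is_derive_unique, @is_derive_plus; now apply smooth_plane_is_derive_x.
Qed.

Lemma smooth_plane_dt_plus (f g : field) (x t : R) :
  smooth_plane f -> smooth_plane g ->
  dt (fun y s => f y s + g y s) x t = dt f x t + dt g x t.
Proof.
  intros; apply is_derive_unique, @is_derive_plus; now apply smooth_plane_is_derive_t.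
Qed.

Lemma smooth_plane_dx_mult (f g : field) (x t : R) :
  smooth_plane f -> smooth_plane g ->
  dx (fun y s => f y s * g y s) x t = dx f x t * g x t + f x t * dx g x t.
Proof.
  intros; apply is_derive_unique.
  apply (is_derive_mult_R (fun y => f y t) (fun y => g y t));
    now apply smooth_plane_is_derive_x.
Qed.

Lemma smooth_plane_dt_mult (f g : field) (x t : R) :
  smooth_plane f -> smooth_plane g ->
  dt (fun y s => f y s * g y s) x t = dt f x t * g x t + f x t * dt g x t.
Proof.
  intros; apply is_derive_unique.
  apply (is_derive_mult_R (fun s => f x s) (fun s => g x s));
    now apply smooth_plane_is_derive_t.
Qed.

Lemma dx_scal (a : R) (f : field) (x t : R) :
  dx (fun y s => a * f y s) x t = a * dx f x t.
Proof. apply Derive_scal. Qed.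

Lemma dt_scal (a : R) (f : field) (x t : R) :
  dt (fun y s => a * f y s) x t = a * dt f x t.
Proof. apply Derive_scal. Qed.

Lemma smooth_plane_Schwarz (f : field) (x t : R) :
  smooth_plane f -> dx (dt f) x t = dt (dx f) x t.
Proof.
  intros H. apply (Schwarz f x t).
  - exists (mkposreal 1 Rlt_0_1); intros u v _ _.
    split; [|split; [|split]]; eexists.
    + now apply smooth_plane_is_derive_x.
    + now apply smooth_plane_is_derive_t.
    + apply (smooth_plane_is_derive_x (dt f)), smooth_plane_dt, H.
    + apply (smooth_plane_is_derive_t (dx f)), smooth_plane_dx, H.
  - apply (smooth_plane_continuity (dx (dt f))), smooth_plane_dx, smooth_plane_dt, H.
  - apply (smooth_plane_continuity (dt (dx f))), smooth_plane_dt, smooth_plane_dx, H.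
Qed.

(** * Smooth functions of one variable and their composition with fields *)

Lemma smooth_Derive (e : R -> R) : smooth e -> smooth (Derive e).
Proof.
  intros H n p. destruct n as [|n]; [exact I|].
  apply ex_derive_ext with (Derive_n e (S n)).
  - intros y. rewrite <- (Nat.add_1_r n). symmetry. apply (Derive_n_comp e n 1).
  - apply (H (S (S n)) p).
Qed.

Lemma smooth_scal (a : R) (e : R -> R) : smooth e -> smooth (fun p => a * e p).
Proof. intros H n p. apply ex_derive_n_scal_l, H. Qed.

Lemma smooth_is_derive (e : R -> R) (p : R) : smooth e -> is_derive e p (Derive e p).
Proof. intros H. apply Derive_correct, (H 1%nat p). Qed.

Lemma smooth_plane_comp (e : R -> R) (f : field) :
  smooth e -> smooth_plane f -> smooth_plane (fun x t => e (f x t)).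
Proof.
  intros He Hf; apply C_smooth_plane; intro n.
  apply (C_plane_comp smooth); auto using smooth_plane_C.
  intros h Hh. exists (Derive h); split; [now apply smooth_Derive|].
  intros y; now apply smooth_is_derive.
Qed.

Lemma smooth_plane_dx_comp (e : R -> R) (f : field) (x t : R) :
  smooth e -> smooth_plane f ->
  dx (fun y s => e (f y s)) x t = Derive e (f x t) * dx f x t.
Proof.
  intros; apply is_derive_unique. apply (is_derive_comp_R e (fun y => f y t)).
  - now apply smooth_is_derive.
  - now apply smooth_plane_is_derive_x.
Qed.

Lemma smooth_plane_dt_comp (e : R -> R) (f : field) (x t : R) :
  smooth e -> smooth_plane f ->
  dt (fun y s => e (f y s)) x t = Derive e (f x t) * dt f x t.
Proof.
  intros; apply is_derive_unique. apply (is_derive_comp_R e (fun s => f x s)).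
  - now apply smooth_is_derive.
  - now apply smooth_plane_is_derive_t.
Qed.

(** * Bump functions *)

(** The case [k = 0] is the classical smooth function that is flat at the origin. The powers of
    [/ x] are included because they appear when it is differentiated. *)
Definition flat (k : nat) (x : R) : R :=
  if Rlt_dec 0 x then (/ x) ^ k * exp (- / x) else 0.

Lemma flat_pos (k : nat) (x : R) : 0 < x -> 0 < flat k x.
Proof.
  intros H. unfold flat. destruct (Rlt_dec 0 x); [|easy].
  apply Rmult_lt_0_compat; [apply pow_lt, Rinv_0_lt_compat, H | apply exp_pos].
Qed.

Lemma flat_0 (k : nat) (x : R) : x <= 0 -> flat k x = 0.
Proof. intros H. unfold flat. destruct (Rlt_dec 0 x); lra. Qed.

Lemma exp_INR_mult (n : nat) (z : R) : exp (INR n * z) = exp z ^ n.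
Proof.
  induction n as [|n IH].
  - simpl. rewrite Rmult_0_l. apply exp_0.
  - rewrite S_INR, Rmult_plus_distr_r, exp_plus, IH, Rmult_1_l. simpl. ring.
Qed.

(** This is the inequality z <= exp z at z = y / m, multiplied by m and raised to the power m. *)
Lemma pow_le_exp (m : nat) (y : R) :
  (0 < m)%nat -> 0 <= y -> y ^ m <= INR m ^ m * exp y.
Proof.
  intros Hm Hy. assert (Hm' : 0 < INR m) by (apply lt_0_INR, Hm).
  replace (exp y) with (exp (INR m * (y / INR m))) by (f_equal; field; lra).
  rewrite exp_INR_mult, <- Rpow_mult_distr.
  apply pow_incr; split; [exact Hy|].
  pose proof (exp_ineq1_le (y / INR m)) as E.
  apply Rle_trans with (INR m * (y / INR m)); [right; field; lra|].
  apply Rmult_le_compat_l; lra.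
Qed.

(** A quadratic bound is what forces the derivative at 0 to exist and vanish. For positive x it is
    [pow_le_exp] with exponent k + 2 at 1 / x, multiplied by x^2 exp(-1/x). *)
Lemma flat_le (k : nat) (x : R) :
  Rabs (flat k x) <= INR (k + 2) ^ (k + 2) * x ^ 2.
Proof.
  destruct (Rlt_dec 0 x) as [H|H].
  - rewrite Rabs_pos_eq by (left; now apply flat_pos).
    unfold flat. destruct (Rlt_dec 0 x); [|easy].
    assert (Hx : 0 < / x) by now apply Rinv_0_lt_compat.
    pose proof (pow_le_exp (k + 2) (/ x) ltac:(lia) ltac:(lra)) as E.
    rewrite (pow_add (/ x)) in E.
    rewrite exp_Ropp.
    pose proof (exp_pos (/ x)) as P.
    apply Rmult_le_reg_r with (exp (/ x) * (/ x) ^ 2);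
      [apply Rmult_lt_0_compat; [exact P | now apply pow_lt]|].
    replace ((/ x) ^ k * / exp (/ x) * (exp (/ x) * (/ x) ^ 2))
      with ((/ x) ^ k * (/ x) ^ 2) by (field; lra).
    replace (INR (k + 2) ^ (k + 2) * x ^ 2 * (exp (/ x) * (/ x) ^ 2))
      with (INR (k + 2) ^ (k + 2) * exp (/ x)) by (field; lra).
    exact E.
  - rewrite flat_0, Rabs_R0 by lra.
    apply Rmult_le_pos; [apply pow_le, pos_INR | apply pow2_ge_0].
Qed.

Lemma is_derive_flat (k : nat) (x : R) :
  is_derive (flat k) x (flat (k + 2) x - INR k * flat (k + 1) x).
Proof.
  destruct (Rtotal_order x 0) as [H | [H | H]].
  - apply is_derive_ext_loc with (fun _ => 0).
    + exists (mkposreal (- x) ltac:(lra)); intros y Hy.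
      apply Rabs_def2 in Hy; simpl in Hy; unfold minus, plus, opp in Hy; simpl in Hy.
      symmetry; apply flat_0; lra.
    + rewrite !flat_0 by lra. auto_derive; [easy | ring].
  - subst x. rewrite !flat_0 by lra.
    replace (0 - INR k * 0) with 0 by ring.
    apply is_derive_Reals. intros eps Heps.
    set (M := INR (k + 2) ^ (k + 2)).
    assert (HM : 0 <= M) by apply pow_le, pos_INR.
    (* The difference quotient at 0 is at most M |h| in absolute value. Dividing by M + 1 instead of
       M keeps the radius well defined when only 0 <= M is known. *)
    exists (mkposreal (eps / (M + 1)) ltac:(apply Rdiv_lt_0_compat; lra)).
    intros h Hh Hd; simpl in Hd.
    rewrite (flat_0 k 0), Rplus_0_l, !Rminus_0_r by lra.
    unfold Rdiv; rewrite Rabs_mult, Rabs_inv.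
    assert (Hh' : 0 < Rabs h) by now apply Rabs_pos_lt.
    apply Rmult_lt_reg_r with (Rabs h); [exact Hh'|].
    rewrite Rmult_assoc, Rinv_l, Rmult_1_r by lra.
    apply Rle_lt_trans with (1 := flat_le k h). fold M.
    rewrite <- pow2_abs.
    assert (E : Rabs h * (M + 1) < eps).
    { replace eps with (eps / (M + 1) * (M + 1)) by (field; lra).
      apply Rmult_lt_compat_r; lra. }
    nra.
  - apply is_derive_ext_loc with (fun y => (/ y) ^ k * exp (- / y)).
    + exists (mkposreal x H); intros y Hy.
      apply Rabs_def2 in Hy; simpl in Hy; unfold minus, plus, opp in Hy; simpl in Hy.
      unfold flat; destruct (Rlt_dec 0 y); lra.
    + unfold flat; destruct (Rlt_dec 0 x); [|lra].
      rewrite !pow_add. auto_derive; [lra|].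
      (* The derivative of the power has exponent [pred k], so k = 0 is treated apart. *)
      destruct k as [|k]; [simpl; field; lra|].
      change (pred (S k)) with k. rewrite <- (tech_pow_Rmult (/ x) k).
      field; lra.
Qed.

(** The derivative of a [flat] is a combination of two others, so their linear span is closed under
    differentiation, as [C_plane_comp] requires. *)
Inductive flat_span : (R -> R) -> Prop :=
| flat_span_flat (k : nat) : flat_span (flat k)
| flat_span_plus (h1 h2 : R -> R) :
    flat_span h1 -> flat_span h2 -> flat_span (fun x => h1 x + h2 x)
| flat_span_scal (a : R) (h : R -> R) :
    flat_span h -> flat_span (fun x => a * h x).

Lemma flat_span_derive (h : R -> R) :
  flat_span h -> exists h', flat_span h' /\ forall x, is_derive h x (h' x).
Proof.
  induction 1 as [k | h1 h2 _ (d1 & S1 & D1) _ (d2 & S2 & D2) | a h _ (d & S & D)].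
  - exists (fun x => flat (k + 2) x + - INR k * flat (k + 1) x); split.
    + apply (flat_span_plus (flat (k + 2))), flat_span_scal; apply flat_span_flat.
    + intros x. replace (flat (k + 2) x + - INR k * flat (k + 1) x)
        with (flat (k + 2) x - INR k * flat (k + 1) x) by ring.
      apply is_derive_flat.
  - exists (fun x => d1 x + d2 x); split; [now apply flat_span_plus|].
    intros x. now apply @is_derive_plus.
  - exists (fun x => a * d x); split; [now apply flat_span_scal|].
    intros x. now apply is_derive_scal.
Qed.

Lemma smooth_plane_flat (f : field) :
  smooth_plane f -> smooth_plane (fun x t => flat 0 (f x t)).
Proof.
  intros H. apply C_smooth_plane. intro n.
  apply (C_plane_comp flat_span flat_span_derive).
  - apply flat_span_flat.
  - now apply smooth_plane_C.
Qed.

Definition bump (l1 l2 s1 s2 : R) : field :=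
  fun x t => flat 0 (x - l1) * flat 0 (l2 - x) * (flat 0 (t - s1) * flat 0 (s2 - t)).

Lemma smooth_plane_bump (l1 l2 s1 s2 : R) : smooth_plane (bump l1 l2 s1 s2).
Proof.
  assert (X : smooth_plane (fun x _ => x)) by (apply C_smooth_plane, C_plane_fst).
  assert (T : smooth_plane (fun _ t => t)) by (apply C_smooth_plane, C_plane_snd).
  unfold bump.
  repeat apply smooth_plane_mult; apply smooth_plane_flat;
    apply smooth_plane_minus; auto using smooth_plane_const.
Qed.

Lemma flat_nonneg (k : nat) (x : R) : 0 <= flat k x.
Proof.
  destruct (Rlt_dec 0 x); [left; now apply flat_pos | right; symmetry; apply flat_0; lra].
Qed.

Lemma bump_nonneg (l1 l2 s1 s2 x t : R) : 0 <= bump l1 l2 s1 s2 x t.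
Proof. repeat apply Rmult_le_pos; apply flat_nonneg. Qed.

Lemma bump_pos (l1 l2 s1 s2 x t : R) :
  l1 < x < l2 -> s1 < t < s2 -> 0 < bump l1 l2 s1 s2 x t.
Proof. intros. repeat apply Rmult_lt_0_compat; apply flat_pos; lra. Qed.

Lemma bump_support (l1 l2 s1 s2 x t : R) :
  ~ ((l1 <= x <= l2) /\ (s1 <= t <= s2)) -> bump l1 l2 s1 s2 x t = 0.
Proof.
  intros H. unfold bump.
  destruct (Rle_dec (x - l1) 0); [rewrite (flat_0 0 (x - l1)) by easy; ring|].
  destruct (Rle_dec (l2 - x) 0); [rewrite (flat_0 0 (l2 - x)) by easy; ring|].
  destruct (Rle_dec (t - s1) 0); [rewrite (flat_0 0 (t - s1)) by easy; ring|].
  destruct (Rle_dec (s2 - t) 0); [rewrite (flat_0 0 (s2 - t)) by easy; ring|].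
  exfalso; apply H; lra.
Qed.

Lemma closed_rectangle (l1 l2 s1 s2 : R) :
  closed (fun p : R * R => (l1 <= fst p <= l2) /\ (s1 <= snd p <= s2)).
Proof.
  assert (F : forall D : R -> Prop, closed D -> closed (fun p : R * R => D (fst p))).
  { intros D. apply (closed_comp (fst : R * R -> R)). intros p; apply continuous_fst. }
  assert (S : forall D : R -> Prop, closed D -> closed (fun p : R * R => D (snd p))).
  { intros D. apply (closed_comp (snd : R * R -> R)). intros p; apply continuous_snd. }
  apply closed_and.
  - apply (F (fun r => l1 <= r <= l2)), closed_and; [apply closed_ge | apply closed_le].
  - apply (S (fun r => s1 <= r <= s2)), closed_and; [apply closed_ge | apply closed_le].
Qed.

(** The closed rectangle of the bump serves as [K]; the strict inequalities place it inside the open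
    domain. *)
Lemma test_field_mult_bump (a1 a2 tau l1 l2 s1 s2 : R) (f : field) :
  a1 < l1 -> l2 < a2 -> 0 < s1 -> s2 < tau -> smooth_plane f ->
  test_field a1 a2 tau (fun x t => f x t * bump l1 l2 s1 s2 x t).
Proof.
  intros H1 H2 H3 H4 Hf. split.
  - apply smooth_plane_mult; [exact Hf | apply smooth_plane_bump].
  - exists (fun p : R * R => (l1 <= fst p <= l2) /\ (s1 <= snd p <= s2)).
    split; [apply closed_rectangle | split].
    + simpl; intros; unfold in_domain; lra.
    + simpl; intros x t Hn. rewrite bump_support by easy. ring.
Qed.

(** * The action and its first variation *)

(** The time integral is the outer one, as in [action], so that the action is such an integral by
    mere unfolding. *)
Definition space_time_integral (a1 a2 tau : R) (f : field) : R :=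
  RInt (fun t => RInt (fun x => f x t) a1 a2) 0 tau.

Lemma space_time_integral_ext (a1 a2 tau : R) (f g : field) :
  a1 < a2 -> 0 < tau ->
  (forall x t, in_domain a1 a2 tau x t -> f x t = g x t) ->
  space_time_integral a1 a2 tau f = space_time_integral a1 a2 tau g.
Proof.
  intros Ha Ht H. apply RInt_ext; intros t Ht'. apply RInt_ext; intros x Hx.
  rewrite Rmin_left, Rmax_right in * by lra. now apply H.
Qed.

Lemma ex_RInt_smooth_x (f : field) (a b t : R) :
  smooth_plane f -> ex_RInt (fun x => f x t) a b.
Proof.
  intros H. apply (ex_RInt_continuous (V := R_CompleteNormedModule)).
  intros; now apply smooth_plane_continuous_x.
Qed.

(** Differentiation under the integral sign, justified by the joint continuity of [dt f]. It also
    yields continuity in time of the inner integral, hence existence of the outer one. *)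
Lemma is_derive_RInt_x (f : field) (a b t : R) :
  smooth_plane f ->
  is_derive (fun s => RInt (fun x => f x s) a b) t (RInt (fun x => dt f x t) a b).
Proof.
  intros H. apply (is_derive_RInt_param (fun s x => f x s)).
  - apply filter_forall; intros s x _. eexists. now apply smooth_plane_is_derive_t.
  - intros x _ eps.
    destruct (smooth_plane_continuity (dt f) x t (smooth_plane_dt f H) eps) as [d Hd].
    exists d; intros u v Hu Hv. now apply Hd.
  - apply filter_forall; intros s. now apply ex_RInt_smooth_x.
Qed.

Lemma continuous_RInt_x (f : field) (a b t : R) :
  smooth_plane f -> continuous (fun s => RInt (fun x => f x s) a b) t.
Proof.
  intros H. apply (ex_derive_continuous (fun s => RInt (fun x => f x s) a b)).
  eexists; now apply is_derive_RInt_x.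
Qed.

Lemma ex_RInt_RInt_x (f : field) (a b c d : R) :
  smooth_plane f -> ex_RInt (fun t => RInt (fun x => f x t) a b) c d.
Proof.
  intros H. apply (ex_RInt_continuous (V := R_CompleteNormedModule)).
  intros; now apply continuous_RInt_x.
Qed.

Lemma space_time_integral_plus (a1 a2 tau : R) (f g : field) :
  smooth_plane f -> smooth_plane g ->
  space_time_integral a1 a2 tau (fun x t => f x t + g x t)
  = space_time_integral a1 a2 tau f + space_time_integral a1 a2 tau g.
Proof.
  intros Hf Hg. unfold space_time_integral.
  rewrite <- (RInt_plus (V := R_CompleteNormedModule)) by now apply ex_RInt_RInt_x.
  apply RInt_ext; intros t _.
  now rewrite <- (RInt_plus (V := R_CompleteNormedModule)) by now apply ex_RInt_smooth_x.
Qed.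

Lemma space_time_integral_scal (a1 a2 tau k : R) (f : field) :
  smooth_plane f ->
  space_time_integral a1 a2 tau (fun x t => k * f x t)
  = k * space_time_integral a1 a2 tau f.
Proof.
  intros Hf. unfold space_time_integral.
  change (k * ?y) with (scal k y).
  rewrite <- (RInt_scal (V := R_CompleteNormedModule)) by now apply ex_RInt_RInt_x.
  apply RInt_ext; intros t _.
  now rewrite <- (RInt_scal (V := R_CompleteNormedModule)) by now apply ex_RInt_smooth_x.
Qed.

Lemma space_time_integral_dx (a1 a2 tau : R) (f : field) :
  smooth_plane f -> (forall t, f a1 t = 0) -> (forall t, f a2 t = 0) ->
  space_time_integral a1 a2 tau (dx f) = 0.
Proof.
  intros Hf H1 H2. unfold space_time_integral.
  rewrite (RInt_ext _ (fun _ => 0)).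
  - rewrite RInt_const. apply Rmult_0_r.
  - intros t _. transitivity (f a2 t - f a1 t).
    + apply (RInt_Derive (fun x => f x t)).
      * intros x _. eexists. now apply smooth_plane_is_derive_x.
      * intros x _. now apply (smooth_plane_continuous_x (dx f)), smooth_plane_dx.
    + rewrite H1, H2. apply Rminus_diag_eq; reflexivity.
Qed.

(** The inner integral of [dt f] is the time derivative of the inner integral of [f], so the
    fundamental theorem of calculus applies to the outer integral without exchanging the order of
    integration. *)
Lemma space_time_integral_dt (a1 a2 tau : R) (f : field) :
  smooth_plane f -> (forall x, f x 0 = 0) -> (forall x, f x tau = 0) ->
  space_time_integral a1 a2 tau (dt f) = 0.
Proof.
  intros Hf H1 H2. unfold space_time_integral.
  apply (is_RInt_unique (V := R_CompleteNormedModule)).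
  (* The first [0] is the initial time; only the second, the value of the integral, is rewritten. *)
  replace 0 with (minus (RInt (fun x => f x tau) a1 a2) (RInt (fun x => f x 0) a1 a2)) at 2.
  - apply (is_RInt_derive (V := R_CompleteNormedModule)
             (fun t => RInt (fun x => f x t) a1 a2)).
    + intros t _. now apply is_derive_RInt_x.
    + intros t _. now apply (continuous_RInt_x (dt f)), smooth_plane_dt.
  - rewrite (RInt_ext (fun x => f x tau) (fun x => f x 0)).
    + apply Rminus_diag_eq. reflexivity.
    + intros x _. now rewrite H1, H2.
Qed.

(** The primitive of [f] from [a] is nondecreasing and vanishes at both ends,
    so it vanishes throughout, and so does its derivative. *)
Lemma continuous_RInt_eq_0 (f : R -> R) (a b : R) :
  (forall x, continuous f x) -> (forall x, 0 <= f x) ->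
  RInt f a b = 0 -> forall x, a < x < b -> f x = 0.
Proof.
  intros C P Z x Hx.
  assert (E : forall c d, ex_RInt f c d)
    by (intros; apply (ex_RInt_continuous (V := R_CompleteNormedModule)); auto).
  assert (F : forall y, a < y < b -> RInt f a y = 0).
  { intros y Hy.
    pose proof (RInt_Chasles (V := R_CompleteNormedModule) f a y b (E _ _) (E _ _)) as S.
    change (RInt f a y + RInt f y b = RInt f a b) in S.
    pose proof (RInt_ge_0 f a y ltac:(lra) (E _ _) ltac:(auto)).
    pose proof (RInt_ge_0 f y b ltac:(lra) (E _ _) ltac:(auto)).
    lra. }
  assert (D : is_derive (RInt f a) x (f x)).
  { apply (is_derive_RInt f (RInt f a) a x); [|apply C].
    apply filter_forall; intros y. apply (RInt_correct (V := R_CompleteNormedModule)), E. }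
  apply is_derive_unique in D. rewrite <- D.
  rewrite (Derive_ext_loc _ (fun _ => 0)); [apply Derive_const|].
  assert (O : locally x (fun y => a < y < b)) by (apply open_and; auto using open_gt, open_lt).
  revert O; apply filter_imp; exact F.
Qed.

(** The one-dimensional statement is used twice: in time it makes the inner integral vanish at each
    interior t, and then in space it makes the integrand vanish. *)
Lemma space_time_integral_eq_0 (a1 a2 tau : R) (f : field) :
  a1 < a2 -> smooth_plane f -> (forall x t, 0 <= f x t) ->
  space_time_integral a1 a2 tau f = 0 ->
  forall x t, in_domain a1 a2 tau x t -> f x t = 0.
Proof.
  intros Ha Hf P Z x t [Hx Ht].
  apply (continuous_RInt_eq_0 (fun y => f y t) a1 a2); auto.
  - intros; now apply smooth_plane_continuous_x.
  - apply (continuous_RInt_eq_0 (fun s => RInt (fun y => f y s) a1 a2) 0 tau); auto.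
    + intros; now apply continuous_RInt_x.
    + intros s. apply RInt_ge_0; auto using ex_RInt_smooth_x. lra.
Qed.

(** * Replacing fields by others that agree on the open rectangle *)

Lemma dx_ext_domain (a1 a2 tau : R) (f g : field) :
  (forall x t, in_domain a1 a2 tau x t -> f x t = g x t) ->
  forall x t, in_domain a1 a2 tau x t -> dx f x t = dx g x t.
Proof.
  intros H x t [Hx Ht]. apply Derive_ext_loc.
  assert (O : locally x (fun y => a1 < y < a2)) by (apply open_and; auto using open_gt, open_lt).
  revert O; apply filter_imp. intros y Hy. now apply H.
Qed.

Lemma dt_ext_domain (a1 a2 tau : R) (f g : field) :
  (forall x t, in_domain a1 a2 tau x t -> f x t = g x t) ->
  forall x t, in_domain a1 a2 tau x t -> dt f x t = dt g x t.
Proof.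
  intros H x t [Hx Ht]. apply Derive_ext_loc.
  assert (O : locally t (fun s => 0 < s < tau)) by (apply open_and; auto using open_gt, open_lt).
  revert O; apply filter_imp. intros s Hs. now apply H.
Qed.

Lemma smooth_closed_domain (a1 a2 tau : R) (f : field) :
  smooth_closed a1 a2 tau f ->
  exists g, smooth_plane g /\
    forall x t, in_domain a1 a2 tau x t -> f x t = g x t.
Proof.
  intros (g & Hg & E). exists g; split; [exact Hg|].
  intros x t [Hx Ht]. apply E. split; lra.
Qed.

Lemma wave_equation_ext (a1 a2 tau rho0 : R) (c C I J : field) :
  (forall x t, in_domain a1 a2 tau x t -> c x t = C x t) ->
  (forall x t, in_domain a1 a2 tau x t -> I x t = J x t) ->
  wave_equation a1 a2 tau rho0 C J -> wave_equation a1 a2 tau rho0 c I.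
Proof.
  intros Hc HI W x t D. rewrite <- (W x t D). apply f_equal2; [apply f_equal|].
  - apply (dt_ext_domain a1 a2 tau); [|exact D].
    now apply (dt_ext_domain a1 a2 tau).
  - apply (dx_ext_domain a1 a2 tau); [|exact D].
    intros y s D'. f_equal; [now apply Hc | now apply (dx_ext_domain a1 a2 tau)].
Qed.

Lemma action_ext (a1 a2 tau rho0 : R) (c C I J : field) :
  a1 < a2 -> 0 < tau ->
  (forall x t, in_domain a1 a2 tau x t -> c x t = C x t) ->
  (forall x t, in_domain a1 a2 tau x t -> I x t = J x t) ->
  action a1 a2 tau rho0 c I = action a1 a2 tau rho0 C J.
Proof.
  intros Ha Ht Hc HI. apply (space_time_integral_ext a1 a2 tau); auto.
  intros x t D. rewrite (Hc x t D), (dt_ext_domain a1 a2 tau I J HI x t D),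
    (dx_ext_domain a1 a2 tau I J HI x t D). reflexivity.
Qed.

Lemma stationary_ext (a1 a2 tau rho0 : R) (c C I J : field) :
  a1 < a2 -> 0 < tau ->
  (forall x t, in_domain a1 a2 tau x t -> c x t = C x t) ->
  (forall x t, in_domain a1 a2 tau x t -> I x t = J x t) ->
  stationary a1 a2 tau rho0 C J -> stationary a1 a2 tau rho0 c I.
Proof.
  intros Ha Ht Hc HI S phi Hphi.
  eapply is_derive_ext; [|exact (S phi Hphi)].
  intros eps. symmetry. apply action_ext; auto.
  intros x t D. now rewrite HI.
Qed.

(** * Expansion of the action, integration by parts and the fundamental lemma *)

Definition first_variation (a1 a2 tau rho0 : R) (C J phi : field) : R :=
  space_time_integral a1 a2 tau
    (fun x t => rho0 * (dt J x t * dt phi x t) - C x t * (dx J x t * dx phi x t)).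

(** The expansion is exact because the integrand is quadratic in the derivatives of the field. The
    derivative at [eps = 0] can thus be read off from a polynomial in [eps]. *)
Lemma action_perturbation (a1 a2 tau rho0 eps : R) (C J phi : field) :
  smooth_plane C -> smooth_plane J -> smooth_plane phi ->
  action a1 a2 tau rho0 C (fun x t => J x t + eps * phi x t)
  = action a1 a2 tau rho0 C J + eps * first_variation a1 a2 tau rho0 C J phi
    + eps ^ 2 * action a1 a2 tau rho0 C phi.
Proof.
  intros HC HJ Hp. unfold first_variation.
  assert (L : forall f, smooth_plane f -> smooth_plane
    (fun x t => / 2 * (rho0 * dt f x t ^ 2 - C x t * dx f x t ^ 2))).
  { intros f Hf. simpl.
    repeat first [apply smooth_plane_mult | apply smooth_plane_minus
                 | apply smooth_plane_const | apply smooth_plane_dx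
                 | apply smooth_plane_dt | assumption]. }
  assert (V : smooth_plane
    (fun x t => rho0 * (dt J x t * dt phi x t) - C x t * (dx J x t * dx phi x t))).
  { repeat first [apply smooth_plane_mult | apply smooth_plane_minus
                 | apply smooth_plane_const | apply smooth_plane_dx
                 | apply smooth_plane_dt | assumption]. }
  assert (A : forall f, action a1 a2 tau rho0 C f = space_time_integral a1 a2 tau
    (fun x t => / 2 * (rho0 * dt f x t ^ 2 - C x t * dx f x t ^ 2))) by reflexivity.
  rewrite !A.
  rewrite <- !space_time_integral_scal by auto.
  rewrite <- !space_time_integral_plus by auto using smooth_plane_scal, smooth_plane_plus.
  f_equal. do 2 (apply functional_extensionality; intro).
  rewrite smooth_plane_dt_plus, smooth_plane_dx_plus, dx_scal, dt_scal
    by auto using smooth_plane_scal.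
  field.
Qed.

Lemma stationary_first_variation (a1 a2 tau rho0 : R) (C J : field) :
  smooth_plane C -> smooth_plane J ->
  stationary a1 a2 tau rho0 C J <->
  forall phi, test_field a1 a2 tau phi ->
    first_variation a1 a2 tau rho0 C J phi = 0.
Proof.
  intros HC HJ.
  assert (D : forall phi, test_field a1 a2 tau phi ->
    is_derive (fun eps => action a1 a2 tau rho0 C (fun x t => J x t + eps * phi x t)) 0
              (first_variation a1 a2 tau rho0 C J phi)).
  { intros phi [Hp _].
    eapply is_derive_ext; [intros eps; symmetry; now apply action_perturbation|].
    auto_derive; [easy | ring]. }
  split; intros S phi Hphi.
  - rewrite <- (is_derive_unique _ _ _ (D phi Hphi)). apply is_derive_unique, S, Hphi.
  - pose proof (D phi Hphi) as Dp. now rewrite (S phi Hphi) in Dp.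
Qed.

Definition wave_residual (rho0 : R) (C J : field) : field :=
  fun x t => rho0 * dt (dt J) x t - dx (fun y s => C y s * dx J y s) x t.

Lemma smooth_plane_wave_residual (rho0 : R) (C J : field) :
  smooth_plane C -> smooth_plane J -> smooth_plane (wave_residual rho0 C J).
Proof.
  intros. apply smooth_plane_minus.
  - now apply smooth_plane_scal, smooth_plane_dt, smooth_plane_dt.
  - apply smooth_plane_dx, smooth_plane_mult; auto using smooth_plane_dx.
Qed.

(** Used on the boundary of the rectangle, where it removes the boundary terms of the integration by
    parts. *)
Lemma test_field_outside (a1 a2 tau : R) (phi : field) (x t : R) :
  test_field a1 a2 tau phi -> ~ in_domain a1 a2 tau x t -> phi x t = 0.
Proof. intros (_ & K & _ & KD & K0) N. apply K0. intros H; apply N, KD, H. Qed.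

(** With r the residual, the product rule gives the pointwise identity rho0 J_t phi_t - C J_x phi_x
    = rho0 (J_t phi)_t - (C J_x phi)_x - r phi. The two total derivatives integrate to zero since
    phi vanishes on the boundary. *)
Lemma first_variation_by_parts (a1 a2 tau rho0 : R) (C J phi : field) :
  smooth_plane C -> smooth_plane J -> test_field a1 a2 tau phi ->
  first_variation a1 a2 tau rho0 C J phi
  = - space_time_integral a1 a2 tau (fun x t => wave_residual rho0 C J x t * phi x t).
Proof.
  intros HC HJ Hphi.
  assert (Hp : smooth_plane phi) by apply Hphi.
  assert (HR := smooth_plane_wave_residual rho0 C J HC HJ).
  set (f := fun x t => dt J x t * phi x t).
  set (g := fun x t => C x t * dx J x t * phi x t).
  assert (HCJ : smooth_plane (fun x t => C x t * dx J x t))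
    by auto using smooth_plane_mult, smooth_plane_dx.
  assert (Hf : smooth_plane f)
    by (apply smooth_plane_mult; [now apply smooth_plane_dt | assumption]).
  assert (Hg : smooth_plane g) by now apply smooth_plane_mult.
  assert (If : space_time_integral a1 a2 tau (dt f) = 0).
  { apply space_time_integral_dt; auto; intros x; unfold f;
      rewrite (test_field_outside a1 a2 tau phi) by (auto; unfold in_domain; lra); ring. }
  assert (Ig : space_time_integral a1 a2 tau (dx g) = 0).
  { apply space_time_integral_dx; auto; intros t; unfold g;
      rewrite (test_field_outside a1 a2 tau phi) by (auto; unfold in_domain; lra); ring. }
  (* Differences are written as sums with factor -1, the form in which linearity of the integral was
     proved. *)
  transitivity (rho0 * space_time_integral a1 a2 tau (dt f)
    + (-1 * space_time_integral a1 a2 tau (dx g)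
    + -1 * space_time_integral a1 a2 tau (fun x t => wave_residual rho0 C J x t * phi x t)));
    [|rewrite If, Ig; ring].
  assert (HRp : smooth_plane (fun x t => wave_residual rho0 C J x t * phi x t))
    by now apply smooth_plane_mult.
  rewrite <- !space_time_integral_scal by auto using smooth_plane_dx, smooth_plane_dt.
  rewrite <- !space_time_integral_plus
    by auto 6 using smooth_plane_plus, smooth_plane_scal, smooth_plane_dx, smooth_plane_dt.
  unfold first_variation. f_equal. do 2 (apply functional_extensionality; intro).
  unfold f, g.
  rewrite (smooth_plane_dt_mult (dt J)), (smooth_plane_dx_mult (fun x t => C x t * dx J x t))
    by auto using smooth_plane_dt.
  unfold wave_residual. ring.
Qed.

Lemma wave_equation_iff_stationary (a1 a2 tau rho0 : R) (C J : field) :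
  a1 < a2 -> 0 < tau -> smooth_plane C -> smooth_plane J ->
  wave_equation a1 a2 tau rho0 C J <-> stationary a1 a2 tau rho0 C J.
Proof.
  intros Ha Ht HC HJ. rewrite stationary_first_variation by auto.
  split.
  - intros W phi Hphi. rewrite first_variation_by_parts by auto.
    (* Writing the zero integrand as a product lets homogeneity with factor 0 finish the
       computation. *)
    rewrite (space_time_integral_ext _ _ _ _ (fun _ _ => 0 * 0)) by
      (auto; intros x t D; unfold wave_residual; rewrite (W x t D); ring).
    rewrite (space_time_integral_scal _ _ _ 0 (fun _ _ => 0)) by apply smooth_plane_const.
    ring.
  - intros S x t [Hx Hs].
    (* The cut-off residual as test field makes the integrand a square times a bump. *)
    set (b := bump ((a1 + x) / 2) ((x + a2) / 2) (t / 2) ((t + tau) / 2)).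
    set (r := wave_residual rho0 C J).
    assert (Hr : smooth_plane r) by now apply smooth_plane_wave_residual.
    assert (Hphi : test_field a1 a2 tau (fun y s => r y s * b y s))
      by (apply test_field_mult_bump; auto; lra).
    specialize (S _ Hphi). rewrite first_variation_by_parts in S by auto.
    assert (Z : r x t * (r x t * b x t) = 0).
    { apply (space_time_integral_eq_0 a1 a2 tau (fun y s => r y s * (r y s * b y s)));
        auto; [| | |now split].
      - apply smooth_plane_mult; [auto | apply Hphi].
      - intros y s. rewrite <- Rmult_assoc. apply Rmult_le_pos; [|apply bump_nonneg].
        apply Rle_0_sqr.
      - fold r in S; lra. }
    assert (P : 0 < b x t) by (apply bump_pos; lra).
    change (r x t = 0). apply Rmult_integral in Z as [Z | Z]; [exact Z|].
    apply Rmult_integral in Z as [Z | Z]; [exact Z | lra].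
Qed.

(** * The wave equation for the total energy *)

Lemma wave_equation_total_energy (a1 a2 tau rho0 : R) (e : R -> R) (g : field) :
  smooth e -> smooth_plane g ->
  momentum_balance a1 a2 tau rho0 e g ->
  energy_balance a1 a2 tau rho0 e g ->
  wave_equation a1 a2 tau rho0 (modulus rho0 e g) (total_energy e g).
Proof.
  intros He Hg Mb Eb x t D.
  assert (HS : smooth (stress rho0 e)) by now apply smooth_scal, smooth_Derive.
  assert (Hx := smooth_plane_dx g Hg).
  assert (Hv : smooth_plane (velocity g)) by now apply smooth_plane_dt.
  assert (Hs : smooth_plane (fun y s => stress rho0 e (dx g y s)))
    by now apply smooth_plane_comp.
  set (F := fun y s => velocity g y s * stress rho0 e (dx g y s)).
  assert (HF : smooth_plane F) by now apply smooth_plane_mult.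
  (* Energy balance holds on an open set, so it may be differentiated in time. *)
  replace (rho0 * dt (dt (total_energy e g)) x t) with (dt (dx F) x t).
  2:{ rewrite <- dt_scal. symmetry. apply (dt_ext_domain a1 a2 tau); auto. }
  (* Both sides are x-derivatives: momentum balance gives c I_x = (v S)_t. *)
  rewrite <- smooth_plane_Schwarz by exact HF.
  apply Rminus_diag_eq.
  apply (dx_ext_domain a1 a2 tau); [|exact D]. clear x t D. intros x t D.
  specialize (Mb x t D).
  rewrite smooth_plane_dx_comp in Mb by auto.
  unfold F. rewrite smooth_plane_dt_mult by auto.
  rewrite (smooth_plane_dt_comp (stress rho0 e) (dx g)) by auto.
  (* Simplification turns the square of v into [v * (v * 1)], which is why the constant field 1 is
     differentiated below. *)
  unfold total_energy. simpl.
  rewrite (smooth_plane_dx_plus (fun y s => e (dx g y s)))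
    by (auto using smooth_plane_comp, smooth_plane_mult, smooth_plane_const).
  rewrite smooth_plane_dx_comp by auto.
  rewrite dx_scal, (smooth_plane_dx_mult (velocity g))
    by auto using smooth_plane_mult, smooth_plane_const.
  rewrite (smooth_plane_dx_mult (velocity g) (fun _ _ => 1)) by auto using smooth_plane_const.
  replace (dx (fun _ _ => 1) x t) with 0 by (symmetry; apply (Derive_const 1 x)).
  replace (dt (dx g) x t) with (dx (velocity g) x t) by now apply smooth_plane_Schwarz.
  unfold modulus.
  replace (stress rho0 e (dx g x t)) with (rho0 * Derive e (dx g x t)) by reflexivity.
  (* Here S = rho0 e' matters: v_t S = e' (rho0 v_t), and momentum balance replaces rho0 v_t by S'
     u_xx. This produces the term S' e' u_xx of c I_x; the other term, S' v v_x, comes from v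
     S_t. *)
  replace (dt (velocity g) x t * (rho0 * Derive e (dx g x t)))
    with (Derive e (dx g x t) * (rho0 * dt (velocity g) x t)) by ring.
  rewrite Mb. field.
Qed.

Theorem theorem1 :
  forall (a1 a2 tau rho0 : R) (e : R -> R) (u : field),
    a1 < a2 -> 0 < tau -> 0 < rho0 ->
    smooth e ->
    smooth_closed a1 a2 tau u ->
    momentum_balance a1 a2 tau rho0 e u ->
    energy_balance a1 a2 tau rho0 e u ->
    wave_equation a1 a2 tau rho0 (modulus rho0 e u) (total_energy e u) /\
    stationary a1 a2 tau rho0 (modulus rho0 e u) (total_energy e u) /\
    (forall I : field, smooth_closed a1 a2 tau I ->
      (wave_equation a1 a2 tau rho0 (modulus rho0 e u) I <->
       stationary a1 a2 tau rho0 (modulus rho0 e u) I)).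
Proof.
  intros a1 a2 tau rho0 e u Ha Ht _ He Hu Mb Eb.
  (* From here on u is traded for a field [g] smooth on the whole plane, and both balance laws and
     all derived fields are carried over to it on the open rectangle. *)
  destruct (smooth_closed_domain _ _ _ _ Hu) as (g & Hg & E).
  assert (Ex := dx_ext_domain a1 a2 tau u g E).
  assert (Ev : forall x t, in_domain a1 a2 tau x t -> velocity u x t = velocity g x t)
    by exact (dt_ext_domain a1 a2 tau u g E).
  assert (Ec : forall x t, in_domain a1 a2 tau x t ->
                 modulus rho0 e u x t = modulus rho0 e g x t)
    by (intros x t D; unfold modulus; now rewrite Ex).
  assert (Ee : forall x t, in_domain a1 a2 tau x t ->
                 total_energy e u x t = total_energy e g x t)
    by (intros x t D; unfold total_energy; now rewrite Ex, Ev).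
  assert (Mg : momentum_balance a1 a2 tau rho0 e g).
  { intros x t D. rewrite <- (dt_ext_domain a1 a2 tau _ _ Ev x t D), Mb by exact D.
    apply (dx_ext_domain a1 a2 tau); [|exact D].
    intros y s D'. now rewrite Ex. }
  assert (Eg : energy_balance a1 a2 tau rho0 e g).
  { intros x t D. rewrite <- (dt_ext_domain a1 a2 tau _ _ Ee x t D), Eb by exact D.
    apply (dx_ext_domain a1 a2 tau); [|exact D].
    intros y s D'. now rewrite Ex, Ev. }
  assert (HC : smooth_plane (modulus rho0 e g)).
  { apply (smooth_plane_comp (Derive (stress rho0 e))); [|now apply smooth_plane_dx].
    now apply smooth_Derive, smooth_scal, smooth_Derive. }
  assert (HJ : smooth_plane (total_energy e g)).
  { apply smooth_plane_plus.
    - apply smooth_plane_comp; auto using smooth_plane_dx.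
    - simpl. repeat apply smooth_plane_mult; auto using smooth_plane_const, smooth_plane_dt. }
  assert (W := wave_equation_total_energy a1 a2 tau rho0 e g He Hg Mg Eg).
  split; [|split].
  - exact (wave_equation_ext _ _ _ _ _ _ _ _ Ec Ee W).
  - apply (stationary_ext _ _ _ _ _ _ _ _ Ha Ht Ec Ee).
    now apply wave_equation_iff_stationary.
  - intros I HI. destruct (smooth_closed_domain _ _ _ _ HI) as (J & HJ' & EI).
    (* The transfer lemmas go in one direction only, and each implication passes to the plane fields
       and back, so the equalities are needed in both orientations. *)
    assert (Ec' : forall x t, in_domain a1 a2 tau x t ->
                    modulus rho0 e g x t = modulus rho0 e u x t)
      by (intros; symmetry; auto).
    assert (EI' : forall x t, in_domain a1 a2 tau x t -> J x t = I x t)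
      by (intros; symmetry; auto).
    split; intros H.
    + apply (stationary_ext _ _ _ _ _ _ _ _ Ha Ht Ec EI).
      apply wave_equation_iff_stationary; auto.
      exact (wave_equation_ext _ _ _ _ _ _ _ _ Ec' EI' H).
    + apply (wave_equation_ext _ _ _ _ _ _ _ _ Ec EI).
      apply wave_equation_iff_stationary; auto.
      exact (stationary_ext _ _ _ _ _ _ _ _ Ha Ht Ec' EI' H).
Qed.
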